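(* Let $\sigma(x)=\max(0,x)$ be the ReLU activation, and let $K_\sigma$ and $M_\sigma$ be the Gaussian covariance and mean functions of $\sigma$ defined in the context. Then $$\begin{aligned}K_\sigma(\mu_1,\mu_2;\nu_{11},\nu_{22},\nu_{12})={}&\mu_2\sqrt{\nu_{11}}\,\Phi_{2;1}\!\left(\frac{\mu_1}{\sqrt{\nu_{11}}},\frac{\mu_2}{\sqrt{\nu_{22}}};\frac{\nu_{12}}{\sqrt{\nu_{11}\nu_{22}}}\right)\\&+\mu_1\sqrt{\nu_{22}}\,\Phi_{2;1}\!\left(\frac{\mu_2}{\sqrt{\nu_{22}}},\frac{\mu_1}{\sqrt{\nu_{11}}};\frac{\nu_{12}}{\sqrt{\nu_{11}\nu_{22}}}\right)\\&+\left(\sqrt{\nu_{11}\nu_{22}}-\frac{\nu_{12}^2}{\sqrt{\nu_{11}\nu_{22}}}\right)\phi_2\!\left(\frac{\mu_1}{\sqrt{\nu_{11}}},\frac{\mu_2}{\sqrt{\nu_{22}}};\frac{\nu_{12}}{\sqrt{\nu_{11}\nu_{22}}}\right)\\&+(\mu_1\mu_2+\nu_{12})\,\Phi_2\!\left(\frac{\mu_1}{\sqrt{\nu_{11}}},\frac{\mu_2}{\sqrt{\nu_{22}}};\frac{\nu_{12}}{\sqrt{\nu_{11}\nu_{22}}}\right)\\&-M_\sigma(\mu_1;\nu_{11})\,M_\sigma(\mu_2;\nu_{22}).\end{aligned}$$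
   Context: $M_\sigma:\mathbb R\times\mathbb R_+\to\mathbb R$ is defined by $M_\sigma(\mu;\nu):=\mathbb E\,\sigma(X)$, where $X\sim\mathcal N(\mu,\nu)$. $K_\sigma:\mathbb R^2\times\mathbb R^{2\times 2}_{\ge 0}\to\mathbb R$ (the second factor being the covariance matrices) is defined by $K_\sigma(\mu_1,\mu_2;\nu_{11},\nu_{22},\nu_{12}):=\operatorname{Cov}(\sigma(X_1),\sigma(X_2))$, where $(X_1,X_2)$ is jointly normal with means $\mu_1,\mu_2$ and covariance matrix $\begin{pmatrix}\nu_{11}&\nu_{12}\\ \nu_{12}&\nu_{22}\end{pmatrix}$. $\Phi_2(h,k;\rho)=\mathbb P[Z_1\le h,Z_2\le k]$ is the bivariate normal CDF, where $(Z_1,Z_2)$ is jointly normal with zero means, unit variances and correlation $\rho$; $\phi_2(h,k;\rho)=\frac{\partial^2}{\partial h\,\partial k}\Phi_2(h,k;\rho)$ is the bivariate normal density; $\Phi_{2;1}(h,k;\rho)=\frac{\partial}{\partial h}\Phi_2(h,k;\rho)$ is the partial derivative of the joint CDF in its first argument. *)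

(* Defs.v *)
From HB Require Import structures.
From mathcomp Require Import all_boot all_order all_algebra.
From mathcomp Require Import all_classical all_reals all_analysis.

Set Implicit Arguments.
Unset Strict Implicit.
Unset Printing Implicit Defensive.

Import Order.TTheory GRing.Theory Num.Theory.
Import numFieldNormedType.Exports.

Local Open Scope classical_set_scope.
Local Open Scope ring_scope.

Definition relu {R : realType} (x : R) : R := Num.max 0 x.

(* The law N(m, v), parametrized by the variance [v].  The library's
   [normal_prob m s] takes the standard deviation and is the uniform law on
   [0, 1] when s = 0, so the degenerate law is given explicitly. *)
Definition normal_law {R : realType} (m v : R) :
    probability (measurableTypeR R) R :=
  if v == 0 then (@dirac _ (measurableTypeR R) m R : probability _ R)
  else (normal_prob m (Num.sqrt v) : probability _ R).

Definition Msigma {R : realType} (sigma : R -> R) (m v : R) : R :=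
  fine ('E_(normal_law m v)[sigma])%E.

(* The space R * R whose two coordinates are independent N(0, 1) variables. *)
Definition std_normal2 {R : realType} :
    probability (measurableTypeR R * measurableTypeR R)%type R :=
  (normal_prob (0 : R) 1 \x normal_prob (0 : R) 1)%E.

(* (gauss1 m1 v11, gauss2 m2 v11 v22 v12) is the jointly normal pair m + A z,
   where z is standard normal and A is the lower triangular matrix
     [ sqrt v11         0                        ]
     [ v12 / sqrt v11   sqrt (v22 - v12^2 / v11) ].
   As soon as V = [v11 v12; v12 v22] is positive semidefinite, A A^T = V; this
   includes v11 = 0, which forces v12 = 0, because x / 0 = 0. *)
Definition gauss1 {R : realType} (m1 v11 : R) (z : R * R) : R :=
  m1 + Num.sqrt v11 * z.1.

Definition gauss2 {R : realType} (m2 v11 v22 v12 : R) (z : R * R) : R :=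
  m2 + v12 / Num.sqrt v11 * z.1 + Num.sqrt (v22 - v12 ^+ 2 / v11) * z.2.

Definition Ksigma {R : realType} (sigma : R -> R) (m1 m2 v11 v22 v12 : R) : R :=
  fine (covariance std_normal2
          (sigma \o gauss1 m1 v11) (sigma \o gauss2 m2 v11 v22 v12)).

Definition Phi2 {R : realType} (h k rho : R) : R :=
  fine (std_normal2
          [set z : R * R | gauss1 0 1 z <= h /\ gauss2 0 1 1 rho z <= k]).

Definition Phi2_1 {R : realType} (h k rho : R) : R :=
  derive1 (fun t => Phi2 t k rho) h.

Definition phi2 {R : realType} (h k rho : R) : R :=
  derive1 (fun s => derive1 (fun t => Phi2 s t rho) k) h.

(* [derive1] is total; this says that the derivative [Phi2_1 h k rho] exists.
   It always does when |rho| < 1; when rho = 1 (resp. -1) it fails exactly on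
   the line h = k (resp. h = - k). *)
Definition Phi2_1_exists {R : realType} (h k rho : R) : Prop :=
  derivable (fun t => Phi2 t k rho) h 1.

(* Main.v *)
(* Standardise: h = mu1 / sqrt nu11, k = mu2 / sqrt nu22, r the correlation and
   c = sqrt (1 - r^2); relu is positively homogeneous.  Write phi, Phi for the
   standard normal density and distribution function.

   If r^2 < 1, integrating out the second coordinate turns E[relu relu] into
   the integral over x <= h of (h - x) (m Phi(m/c) + c phi(m/c)) phi(x) with
   m = k - r x, and Phi2 h k r into the integral of phi(x) Phi(m/c).  The
   function
     A(x) = phi(x) Phi(m/c) (h r + k - r x) + c phi(x) phi(m/c)
            + h phi(k) Phi((x - r k) / c)
   is a primitive of the first integrand minus (h k + r) times the second, and
   vanishes at -oo; A(h) consists of the three derivative terms of the formula,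
   because Phi2_1 h k r = phi(h) Phi((k - r h) / c) and
   phi2 h k r = phi(h) phi((k - r h) / c) / c.  For phi2 one differentiates in
   the second argument first, using that (z1, r z1 + c z2) is exchangeable.

   If r = 1 or r = -1 everything reduces to one Gaussian variable, and Phi2 is
   non differentiable exactly on the line excluded by the hypothesis. *)
Require Import Defs.
From HB Require Import structures.
From mathcomp Require Import all_boot all_order all_algebra.
From mathcomp Require Import all_classical all_reals all_analysis.
From mathcomp Require Import measurable_realfun ring lra.
Import Order.TTheory GRing.Theory Num.Theory.
Import numFieldNormedType.Exports.

Set Implicit Arguments.
Unset Strict Implicit.
Unset Printing Implicit Defensive.

Local Open Scope classical_set_scope.
Local Open Scope ring_scope.

Local Notation leb := lebesgue_measure.
Local Notation gauss := (normal_prob 0 1).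

(** * Changes of variables for normal laws *)

(** The Radon-Nikodym derivative and [normal_pdf] have the same integral on every measurable set,
    hence agree almost everywhere. *)
Lemma ge0_integral_normal_prob (R : realType) (m s : R) (f : R -> \bar R) :
  measurable_fun setT f -> (forall x, 0 <= f x)%E ->
  (\int[normal_prob m s]_x f x =
   \int[leb]_x (f x * (normal_pdf m s x)%:E))%E.
Proof.
move=> mf f0; have dom := normal_prob_dominates m s.
rewrite -(Radon_Nikodym_SigmaFinite.change_of_variables dom)//.
pose rn := Radon_Nikodym_SigmaFinite.f (normal_prob m s) leb.
have irn := Radon_Nikodym_SigmaFinite.f_integrable dom.
have mrn : measurable_fun setT rn by exact: measurable_int irn.
have mpdf : measurable_fun setT (fun x => (normal_pdf m s x)%:E).
  by apply/measurable_EFinP; exact: measurable_normal_pdf.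
apply: ae_eq_integral => //; [exact: emeasurable_funM|exact: emeasurable_funM|].
apply: ae_eqe_mul2l; apply: integral_ae_eq => //.
by move=> E _ mE; rewrite -Radon_Nikodym_SigmaFinite.f_integral.
Qed.

(** Closed rays are stable under intersection, generate the Borel sets and, ending at the naturals,
    exhaust the line. *)
Lemma eq_measure_ray (R : realType)
    (m1 m2 : {finite_measure set (measurableTypeR R) -> \bar R}) :
  (forall x : R, m1 [set` `]-oo, x]] = m2 [set` `]-oo, x]]) ->
  forall A, measurable A -> m1 A = m2 A.
Proof.
move=> m12; pose G : set (set (measurableTypeR R)) :=
  [set A | exists x, A = [set` `]-oo, x]]].
move=> A mA.
apply: (@measure_unique _ R (measurableTypeR R) G
  (fun n => [set` `]-oo, n%:R]]) _ _ _ _ m1 m2 _ _ _ mA).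
- apply/seteqP; split.
    rewrite RGenInftyO.measurableE; apply: smallest_sub => [|B [x ->]].
      exact: smallest_sigma_algebra.
    (* The Borel sets are generated here by open rays, each a countable union of closed ones. *)
    rewrite (_ : [set` _] =
        \bigcup_n [set` `]-oo, x - n.+1%:R^-1]]); last first.
      apply/seteqP; split => y /=; rewrite in_itv/=.
        move=> yx; have [n xn] := ltr_add_invr yx.
        exists n => //=; rewrite in_itv/= lerBrDr ltW//.
      move=> [n _] /=; rewrite in_itv/= => /le_lt_trans; apply.
      by rewrite gtrBl.
    apply: (@bigcupT_measurable _ (g_sigma_algebraType G)) => n.
    by apply: sub_sigma_algebra; eexists.
  apply: smallest_sub; first exact: sigma_algebra_measurable.
  by move=> B [x ->]; exact: measurable_itv.
- move=> _ _ [x ->] [y ->]; exists (Num.min x y).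
  by apply/seteqP; split => z /=; rewrite !in_itv/= le_min => /andP.
- by move=> n; exists n%:R.
- apply/seteqP; split => // x _; exists (Num.truncn `|x|).+1 => //=.
  by rewrite in_itv/= (le_trans (ler_norm _))// ltW// truncnS_gt.
- by move=> _ [x ->]; exact: m12.
- by move=> n; rewrite ltey_eq fin_num_measure.
Qed.

Lemma normal_pdf_affine (R : realType) (m s x : R) : 0 < s ->
  normal_pdf m s (m + s * x) * s = normal_pdf 0 1 x.
Proof.
move=> s0; rewrite !normal_pdfE ?gt_eqF//.
rewrite /normal_peak /normal_fun expr1n mul1r subr0.
rewrite -mulrnAr sqrtrM ?sqr_ge0// sqrtr_sqr gtr0_norm// invfM.
rewrite mulrC !mulrA mulfV ?gt_eqF// mul1r; congr (_ * expR _).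
by rewrite addrC addKr; field; rewrite gt_eqF.
Qed.

(** The image of [P] under [X] agrees with [Q] on rays, hence everywhere, and the left side is an
    integral against that image. *)
Lemma ge0_integral_transfer (R : realType)
    (P Q : probability (measurableTypeR R) R) (X : R -> R) (f : R -> \bar R) :
  measurable_fun setT X ->
  (forall x, P (X @^-1` [set` `]-oo, x]]) = Q [set` `]-oo, x]]) ->
  measurable_fun setT f -> (forall x, 0 <= f x)%E ->
  (\int[P]_x f (X x) = \int[Q]_x f x)%E.
Proof.
move=> mX PX mf f0.
pose X_mixin :=
  @isMeasurableFun.Build _ _ (measurableTypeR R) (measurableTypeR R) X mX.
pose Y : {mfun measurableTypeR R >-> measurableTypeR R} := HB.pack X X_mixin.
rewrite -[LHS](@ge0_integral_distribution _ _ (measurableTypeR R)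
  (measurableTypeR R) _ P Y f mf f0).
apply: eq_measure_integral => A mA _.
by apply: eq_measure_ray mA => x; exact: PX.
Qed.

Lemma normal_prob_ray_affine (R : realType) (m s x : R) : 0 < s ->
  normal_prob m s `]-oo, m + s * x] = gauss `]-oo, x].
Proof.
move=> s0; pose X x : R := m + s * x.
have cX : continuous X.
  by move=> z; apply: cvgD; [exact: cvg_cst|apply: cvgMr; exact: cvg_id].
have dX (z : R) : is_derive z 1 X s.
  by rewrite /X; apply: is_derive_eq; rewrite add0r mul1r /GRing.scale/= mulr1.
have X'E : derive1 X = cst s.
  by apply/funext => z; rewrite derive1E; exact: derive_val.
rewrite /normal_prob -/(X x) increasing_ge0_integration_by_substitutionNy ?X'E.
- by apply: eq_integral => z _; congr EFin; exact: normal_pdf_affine.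
- by move=> y z _ _ yz; rewrite /X ltrD2l ltr_pM2l.
- by move=> *; exact: cvg_cst.
- exact: is_cvg_cst.
- exact: cvg_cst.
- split => [z _|]; first exact: ex_derive.
  by apply: cvg_at_left_filter; exact: cX.
- rewrite /X; apply/cvgrNyPle => A; near=> z.
  by rewrite -lerBrDl -ler_pdivlMl//.
- apply: continuous_subspaceT; apply: continuous_normal_pdf; exact: lt0r_neq0.
- by move=> *; exact: normal_pdf_ge0.
Unshelve. all: by end_near. Qed.

Lemma ge0_integral_normal_affine (R : realType) (m s : R) (f : R -> \bar R) :
  0 < s -> measurable_fun setT f -> (forall x, 0 <= f x)%E ->
  (\int[gauss]_x f (m + s * x)%R = \int[normal_prob m s]_x f x)%E.
Proof.
move=> s0 mf f0.
apply: (@ge0_integral_transfer _ gauss (normal_prob m s)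
  (fun x => m + s * x)) => //.
  by apply: measurable_funD => //; exact: measurable_funM.
move=> x.
have xE : x = m + s * ((x - m) / s).
  by rewrite mulrCA mulfV ?gt_eqF// mulr1 subrKC.
transitivity (gauss [set` `]-oo, (x - m) / s]]); last first.
  by rewrite [in RHS]xE; exact/esym/normal_prob_ray_affine.
congr (gauss _).
by apply/seteqP; split => z /=; rewrite !in_itv/= ler_pdivlMr// lerBrDl mulrC.
Qed.

Lemma gauss_pdfN (R : realType) (x : R) :
  normal_pdf 0 1 (- x) = normal_pdf 0 1 x.
Proof. by rewrite !normal_pdfE// /normal_fun !subr0 sqrrN. Qed.

Lemma ge0_integral_gaussN (R : realType) (f : R -> \bar R) :
  measurable_fun setT f -> (forall x, 0 <= f x)%E ->
  (\int[gauss]_x f (- x)%R = \int[gauss]_x f x)%E.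
Proof.
move=> mf f0.
apply: (@ge0_integral_transfer _ gauss gauss -%R) => // x.
rewrite /= /normal_prob -[in RHS](opprK x) ge0_integration_by_substitutionNy//.
- rewrite (_ : _ @^-1` _ = [set` `[- x, +oo[]); last first.
    by apply/seteqP; split => z /=; rewrite !in_itv/= andbT lerNl.
  by apply: eq_integral => z _ /=; rewrite gauss_pdfN.
- by apply: continuous_subspaceT; exact: continuous_normal_pdf.
- by move=> *; exact: normal_pdf_ge0.
Qed.

(** * Correlated Gaussian pairs *)

Lemma ge0_integral_std_normal2 (R : realType) (g : R * R -> \bar R) :
  measurable_fun setT g -> (forall z, 0 <= g z)%E ->
  (\int[std_normal2]_z g z = \int[gauss]_x \int[gauss]_y g (x, y))%E.
Proof. by move=> mg g0; rewrite /std_normal2 fubini_tonelli1. Qed.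

(** Both products are the joint density of a pair with unit variances and correlation [r]: both
    exponents equal [- (x^2 - 2 r x y + y^2) / (2 c^2)]. *)
Lemma normal_pdf_exchange (R : realType) (r c x y : R) :
  0 < c -> r ^+ 2 + c ^+ 2 = 1 ->
  normal_pdf (r * x) c y * normal_pdf 0 1 x =
  normal_pdf (r * y) c x * normal_pdf 0 1 y.
Proof.
move=> c0 rc; rewrite !normal_pdfE ?gt_eqF// mulrACA [RHS]mulrACA.
congr (_ * _); rewrite /normal_fun -!expRD !subr0 expr1n; congr expR.
have c2 : c ^+ 2 != 0 by rewrite sqrf_eq0 gt_eqF.
have cE : c ^+ 2 = 1 - r ^+ 2 by rewrite -rc addrC addKr.
by rewrite cE; field; rewrite -cE.
Qed.

Lemma measurable_normal_pdf2 (R : realType) (r c : R) : c != 0 ->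
  measurable_fun setT (fun z : R * R => normal_pdf (r * z.1) c z.2).
Proof.
move=> c0; rewrite (_ : (fun _ => _) =
    (fun z => normal_peak c * expR (- (z.2 - r * z.1) ^+ 2 / (c ^+ 2 *+ 2)))).
  apply: measurable_funM => //; apply: measurableT_comp => //.
  apply: measurable_funM => //; apply: measurableT_comp => //.
  apply: measurable_funX; apply: measurable_funB => //.
  exact: measurable_funM.
by apply/funext => z; rewrite normal_pdfE.
Qed.

Lemma measurable_gauss_pair (R : realType) (d : measure_display)
    (T : measurableType d) (g : R * R -> T) (r c : R) :
  measurable_fun setT g ->
  measurable_fun setT (fun z : R * R => g (z.1, r * z.1 + c * z.2)).
Proof.
move=> mg; apply: (measurableT_comp mg).
apply: (measurable_fun_pair (f := fst)) => //.
by apply: measurable_funD; apply: measurable_funM.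
Qed.

(** Given the first coordinate [x], the second has mean [r x] and standard deviation [c]; the joint
    density is conditional times marginal. *)
Lemma ge0_integral_gauss_pair_density (R : realType) (r c : R)
    (g : R * R -> \bar R) :
  0 < c -> measurable_fun setT g -> (forall z, 0 <= g z)%E ->
  (\int[std_normal2]_z g (z.1, r * z.1 + c * z.2)%R =
   \int[leb]_x \int[leb]_y
     (g (x, y) * (normal_pdf (r * x) c y * normal_pdf 0 1 x)%:E))%E.
Proof.
move=> c0 mg g0.
have mgp := measurable_gauss_pair r c mg.
rewrite ge0_integral_std_normal2//= ge0_integral_normal_prob//; last 2 first.
- apply: (@measurable_fun_fubini_tonelli_F _ _ _ _ _
      (gauss : probability (measurableTypeR R) R) _ mgp) => z; exact: g0.
- by move=> x; exact: integral_ge0.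
apply: eq_integral => x _.
have mgx : measurable_fun setT (fun y => g (x, y)).
  by apply: measurableT_comp => //; exact: pair1_measurable.
rewrite (ge0_integral_normal_affine (r * x) c0 mgx)//.
rewrite ge0_integral_normal_prob// -ge0_integralZr//.
- by apply: eq_integral => y _; rewrite EFinM muleA.
- apply: emeasurable_funM => //; apply/measurable_EFinP.
  exact: measurable_normal_pdf.
- by move=> y _; rewrite mule_ge0// lee_fin normal_pdf_ge0.
- by rewrite lee_fin normal_pdf_ge0.
Qed.

(* By [normal_pdf_exchange] the joint density is symmetric. *)
Lemma ge0_integral_gauss_pair_swap (R : realType) (r c : R)
    (g : R * R -> \bar R) :
  0 < c -> r ^+ 2 + c ^+ 2 = 1 ->
  measurable_fun setT g -> (forall z, 0 <= g z)%E ->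
  (\int[std_normal2]_z g (z.1, r * z.1 + c * z.2)%R =
   \int[std_normal2]_z g (r * z.1 + c * z.2, z.1)%R)%E.
Proof.
move=> c0 rc mg g0.
have mswap : measurable_fun setT (fun z : R * R => g (z.2, z.1)).
  by apply: (measurableT_comp mg); exact: (measurable_fun_pair (f := snd)).
rewrite ge0_integral_gauss_pair_density//.
rewrite (@ge0_integral_gauss_pair_density _ r c
  (fun z => g (z.2, z.1))) => [|||z]//.
rewrite (@fubini_tonelli _ _ _ _ _ leb leb (fun z =>
  (g z * (normal_pdf (r * z.1) c z.2 * normal_pdf 0 1 z.1)%:E)%E)).
- apply: eq_integral => y _; apply: eq_integral => x _ /=.
  by rewrite normal_pdf_exchange.
- apply: emeasurable_funM => //; apply/measurable_EFinP.
  apply: measurable_funM.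
    by apply: measurable_normal_pdf2; rewrite gt_eqF.
  by apply: measurableT_comp => //; exact: measurable_normal_pdf.
- by move=> z; rewrite mule_ge0// lee_fin mulr_ge0// normal_pdf_ge0.
Qed.

(** * Integration with a primitive *)

(** The fundamental theorem of calculus for [f - q g], put as a reduction of one integral to another
    because the integral of [g] is to survive in the answer. *)
Lemma integral_itv_primitive (R : realType) (f g A : R -> R) (q a b : R) :
  a < b -> continuous f -> continuous g ->
  (forall x : R, is_derive x 1 A (f x - q * g x)) ->
  (\int[leb]_(x in `[a, b]) (f x)%:E =
   (q * fine (\int[leb]_(x in `[a, b]) (g x)%:E) + (A b - A a))%:E)%E.
Proof.
move=> ab cf cg dA.
have cfg : continuous (fun x => f x - q * g x).
  by move=> x; apply: cvgB; [exact: cf|apply: cvgM; [exact: cvg_cst|exact: cg]].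
have cA : continuous A.
  by move=> x; apply/differentiable_continuous/derivable1_diffP.
have int_cont (u : R -> R) : continuous u ->
    leb.-integrable `[a, b] (EFin \o u).
  move=> cu; apply: continuous_compact_integrable; first exact: segment_compact.
  exact: continuous_subspaceT.
have dcont : derivable_oo_LRcontinuous A a b.
  split => [x _| |]; first exact: ex_derive.
    by apply: cvg_at_right_filter; exact: cA.
  by apply: cvg_at_left_filter; exact: cA.
have dE : {in `]a, b[, derive1 A =1 (fun x => f x - q * g x)}.
  by move=> x _; rewrite derive1E; exact: derive_val.
have := continuous_FTC2 ab (continuous_subspaceT cfg) dcont dE.
have iqg : leb.-integrable `[a, b] (fun x => (q%:E * (g x)%:E)%E).
  by apply: integrableZl => //; exact: int_cont.
have -> : (\int[leb]_(x in `[a, b]) (f x - q * g x)%:E =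
    \int[leb]_(x in `[a, b]) (f x)%:E -
    q%:E * \int[leb]_(x in `[a, b]) (g x)%:E)%E.
  rewrite -integralZl//; last exact: int_cont.
  by rewrite -integralB//; exact: int_cont.
have/fineK <- : (\int[leb]_(x in `[a, b]) (f x)%:E)%E \is a fin_num.
  by apply: integrable_fin_num => //; exact: int_cont.
have/fineK <- : (\int[leb]_(x in `[a, b]) (g x)%:E)%E \is a fin_num.
  by apply: integrable_fin_num => //; exact: int_cont.
by rewrite -EFinM -!EFinB => -[<-]; rewrite /= addrC subrK.
Qed.

(** Monotone convergence along the increasing intervals [[h - n, h]]. *)
Lemma cvg_ge0_integral_Nyc (R : realType) (f : R -> R) (h : R) :
  continuous f -> (forall x, x <= h -> 0 <= f x) ->
  (\int[leb]_(x in `[(h - n%:R)%R, h]) (f x)%:E @[n --> \oo] -->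
   \int[leb]_(x in `]-oo, h]) (f x)%:E)%E.
Proof.
move=> cf f0; rewrite itvNy_bnd_bigcup_BLeft.
apply: ge0_nondecreasing_set_cvg_integral => //.
- move=> n m nm; apply/subsetPset; apply: subset_itvr.
  by rewrite bnd_simp lerB// ler_nat.
- move=> n; apply/measurable_EFinP; apply: measurable_funTS.
  exact: continuous_measurable_fun.
- by move=> n x /=; rewrite in_itv/= lee_fin => /andP[_]; exact: f0.
Qed.

(** This is [integral_itv_primitive] on [[h - n, h]] as [n] grows: the boundary term [A (h - n)]
    vanishes in the limit. *)
Lemma ge0_integral_Nyc_primitive (R : realType) (f g A : R -> R) (q I h : R) :
  continuous f -> continuous g ->
  (forall x, x <= h -> 0 <= f x) -> (forall x, 0 <= g x) ->
  (forall x : R, is_derive x 1 A (f x - q * g x)) ->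
  A x @[x --> -oo] --> 0 ->
  (\int[leb]_(x in `]-oo, h]) (g x)%:E = I%:E)%E ->
  (\int[leb]_(x in `]-oo, h]) (f x)%:E = (q * I + A h)%:E)%E.
Proof.
move=> cf cg f0 g0 dA A0 gI.
have cvgI := @cvg_ge0_integral_Nyc _ g h cg (fun x _ => g0 x).
rewrite gI in cvgI.
apply: (cvg_unique _ (@cvg_ge0_integral_Nyc _ f h cf f0)) => //.

have cvgh : h - n%:R @[n --> \oo] --> -oo.
  apply/cvgrNyPle => a; near=> n; rewrite lerBlDl -lerBlDr.
  by near: n; exact: nbhs_infty_ger.
have cvgA : A (h - n%:R) @[n --> \oo] --> 0.
  exact: (cvg_comp _ _ cvgh A0).
have : (q * fine (\int[leb]_(x in `[(h - n%:R)%R, h]) (g x)%:E)%E +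
    (A h - A (h - n%:R)))%:E @[n --> \oo] --> (q * I + A h)%:E.
  apply: cvg_EFin; first by near=> n.
  rewrite -[in X in _ --> X](subr0 (A h)).
  apply: cvgD; first by apply: cvgMr; exact: fine_cvg.
  by apply: cvgB => //; exact: cvg_cst.
move=> cvgR; apply: cvg_trans cvgR; apply: near_eq_cvg; near=> n.
(* The equality is asked for large [n] only, as the lemma requires [h - n < h]. *)
rewrite (@integral_itv_primitive _ f g A q)//.
rewrite gtrBl ltr0n; near: n; exact: nbhs_infty_gt.
Unshelve. all: by end_near. Qed.

(** * The standard normal density and distribution function *)

Definition gauss_cdf {R : realType} (x : R) : R :=
  fine (gauss [set` `]-oo, x]]).

Lemma gauss_cdfE (R : realType) (x : R) :
  gauss [set` `]-oo, x]] = (gauss_cdf x)%:E.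
Proof.
by rewrite /gauss_cdf fineK// (@fin_num_measure _ _ _ (normal_prob 0 1)).
Qed.

Lemma gauss_cdf_ge0 (R : realType) (x : R) : 0 <= gauss_cdf x.
Proof. by rewrite /gauss_cdf fine_ge0. Qed.

Lemma gauss_cdf_le1 (R : realType) (x : R) : gauss_cdf x <= 1.
Proof.
rewrite -lee_fin -gauss_cdfE.
exact: (@probability_le1 _ _ _ (normal_prob 0 1)).
Qed.

Lemma continuous_gauss_pdf (R : realType) :
  continuous (normal_pdf 0 1 : R -> R).
Proof. exact: continuous_normal_pdf. Qed.

Lemma gauss_pdf_gt0 (R : realType) (x : R) : 0 < normal_pdf 0 1 x.
Proof. by rewrite normal_pdfE// mulr_gt0 ?expR_gt0// normal_peak_gt0. Qed.

Lemma integrable_gauss_weight (R : realType) (w : R -> R) (D : set R) :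
  measurable D -> continuous w -> (forall x, 0 <= w x <= 1) ->
  leb.-integrable D (fun x => (normal_pdf 0 1 x * w x)%:E).
Proof.
move=> mD cw w01; apply: (integrableS measurableT) => //.
have mpdf : measurable_fun [set: R] (normal_pdf 0 1 : R -> R).
  exact: measurable_normal_pdf.
apply: le_integrable (integrable_normal_pdf 0 1) => //.
  apply/measurable_EFinP; apply: measurable_funM => //.
  exact: continuous_measurable_fun.
move=> x _ /=; have /andP[w0 w1] := w01 x.
rewrite lee_fin normrM (ger0_norm w0) ger0_norm ?normal_pdf_ge0//.
by rewrite ler_piMr ?normal_pdf_ge0.
Qed.

(** Used with [w = 1] for the derivative of [gauss_cdf], and with [w] a conditional distribution
    function for that of [Phi2]. *)
Lemma is_derive_gauss_weight (R : realType) (w : R -> R) (h : R) :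
  continuous w -> (forall x, 0 <= w x <= 1) ->
  is_derive h 1
    (fun t => fine (\int[leb]_(x in `]-oo, t]) (normal_pdf 0 1 x * w x)%:E)%E)
    (normal_pdf 0 1 h * w h).
Proof.
move=> cw w01; have hh1 : h < h + 1 by rewrite ltrDl.
have [] := @continuous_FTC1 R (fun x => normal_pdf 0 1 x * w x) -oo%O h _ hh1.
- by apply: integrable_gauss_weight.
- by rewrite ltNyr.
- by apply: cvgM; [exact: continuous_gauss_pdf|exact: cw].
by move=> d1 d2; apply: DeriveDef => //; rewrite -derive1E.
Qed.

Lemma is_derive_gauss_cdf (R : realType) (x : R) :
  is_derive x 1 (@gauss_cdf R) (normal_pdf 0 1 x).
Proof.
have := @is_derive_gauss_weight R (cst 1) x; rewrite mulr1.
rewrite (_ : (fun _ => _) = @gauss_cdf R); last first.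
  apply/funext => t; rewrite /gauss_cdf /normal_prob; congr fine.
  by apply: eq_integral => y _; rewrite /= mulr1.
by apply => [y|y]; [exact: cvg_cst|rewrite ler01 lexx].
Qed.

Lemma continuous_gauss_cdf (R : realType) : continuous (@gauss_cdf R).
Proof.
move=> x; apply/differentiable_continuous/derivable1_diffP.
by have [] := is_derive_gauss_cdf x.
Qed.

Lemma integral_gauss_pdf_ray (R : realType) (h : R) :
  (\int[leb]_(x in `]-oo, h]) (normal_pdf 0 1 x)%:E = (gauss_cdf h)%:E)%E.
Proof. exact: gauss_cdfE. Qed.

Lemma is_derive_gauss_pdf (R : realType) (x : R) :
  is_derive x 1 (normal_pdf 0 1 : R -> R) (- x * normal_pdf 0 1 x).
Proof.
rewrite normal_pdfE//.
have dq : is_derive x 1 (fun y : R => - (y - 0) ^+ 2 / (1 ^+ 2 *+ 2)) (- x).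
  apply: is_derive_eq; rewrite /GRing.scale/=; lra.
have := is_derive1_comp (is_derive_expR _) dq.
move=> /(is_deriveM (is_derive_cst (normal_peak 1) x 1)) dE.
apply: (is_derive_eq dE).
rewrite /GRing.scale/= /normal_fun; ring.
Qed.

(** [gauss_cdf] is the distribution function of the identity random variable under the Gaussian
    law. *)
Lemma cvgNy_gauss_cdf (R : realType) : gauss_cdf x @[x --> -oo] --> (0 : R).
Proof.
pose X : measurableTypeR R -> R := idfun.
pose X_mixin := @isMeasurableFun.Build _ _ _ _ X (@measurable_id _ _ setT).
pose Y : {RV (gauss : probability (measurableTypeR R) R) >-> R} :=
  HB.pack X X_mixin.
exact: (fine_cvg (cvg_cdfNy0 Y)).
Qed.

(** Follows from [1 + t <= expR t] at [t = x^2 / 2]. *)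
Lemma sqr_mul_gauss_pdf_le (R : realType) (x : R) :
  x ^+ 2 * normal_pdf 0 1 x <= 2 * normal_peak 1.
Proof.
rewrite normal_pdfE// /normal_fun subr0 expr1n mulrCA [leRHS]mulrC.
rewrite ler_pM2l ?normal_peak_gt0// mulNr expRN ler_pdivrMr ?expR_gt0//.
have := expR_ge1Dx (x ^+ 2 / (1 *+ 2)); lra.
Qed.

Lemma cvgNy_mul_gauss_pdf (R : realType) :
  x * normal_pdf 0 1 x @[x --> -oo] --> (0 : R).
Proof.
apply/cvgr0Pnorm_lt => e e0; near=> x.
have x0 : x < 0 by near: x; apply: nbhs_ninfty_lt; exact: num_real.
(* The threshold makes the bound [2 * normal_peak 1] on [x^2 phi(x)] smaller than [- x * e]. *)
have xe : x < - (2 * normal_peak 1 / e).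
  by near: x; apply: nbhs_ninfty_lt; exact: num_real.
rewrite normrM (ltr0_norm x0) ger0_norm ?normal_pdf_ge0//.
rewrite -(ltr_pM2l (x := - x)) ?oppr_gt0// mulrA mulrNN -expr2.
apply: le_lt_trans (sqr_mul_gauss_pdf_le x) _.
by rewrite -ltr_pdivrMr// ltrNr.
Unshelve. all: by end_near. Qed.

Lemma cvgNy_gauss_pdf (R : realType) :
  normal_pdf 0 1 x @[x --> -oo] --> (0 : R).
Proof.
apply/cvgr0Pnorm_lt => e e0; near=> x.
have x0 : x <= - 1 by near: x; apply: nbhs_ninfty_le; exact: num_real.
apply: (@le_lt_trans _ _ `|x * normal_pdf 0 1 x|).
  have x1 : 1 <= `|x| by have := ler_norm (- x); rewrite normrN; lra.
  by rewrite normrM -[leLHS]mul1r ler_wpM2r.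
by near: x; apply: (cvgr0_norm_lt _ (@cvgNy_mul_gauss_pdf R)).
Unshelve. all: by end_near. Qed.

Lemma cvg0_mul_bounded (R : realType) (F : set_system R) (u v : R -> R)
    (M : R) :
  Filter F -> (forall x, `|v x| <= M) -> u x @[x --> F] --> 0 ->
  u x * v x @[x --> F] --> 0.
Proof.
move=> FF vM u0; apply/cvgr0Pnorm_lt => e e0.
(* [|M| + 1] is a strictly positive bound, by which [e] can be divided. *)
have M1 : 0 < `|M| + 1 by rewrite ltr_wpDl.
near=> x; rewrite normrM.
apply: (@le_lt_trans _ _ (`|u x| * (`|M| + 1))).
  by rewrite ler_wpM2l// (le_trans (vM x))// (le_trans (ler_norm _))// lerDl.
rewrite -ltr_pdivlMr//; near: x.
by apply: cvgr0_norm_lt => //; rewrite divr_gt0.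
Unshelve. all: by end_near. Qed.

(** * Moments of rectified Gaussians *)

Lemma relu_ge0 (R : realType) (x : R) : 0 <= relu x.
Proof. by rewrite /relu le_max lexx. Qed.

Lemma continuous_relu (R : realType) : continuous (@relu R).
Proof. by move=> x; apply: continuous_max; [exact: cvg_cst|exact: cvg_id]. Qed.

Lemma measurable_relu (R : realType) : measurable_fun setT (@relu R).
Proof. by apply: continuous_measurable_fun; exact: continuous_relu. Qed.

Lemma reluM (R : realType) (s x : R) : 0 <= s -> relu (s * x) = s * relu x.
Proof. by move=> s0; rewrite /relu maxr_pMr// mulr0. Qed.

(** The reflection [x -> - x] puts the support of the rectified factor on [x <= h], the ray over
    which [Phi2] integrates. *)
Lemma ge0_integral_gauss_relu (R : realType) (h : R) (v : R -> R) :
  measurable_fun setT v -> (forall x, 0 <= v x) ->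
  (\int[gauss]_x (relu (h + x) * v x)%:E =
   \int[leb]_(x in `]-oo, h]) ((h - x) * v (- x) * normal_pdf 0 1 x)%:E)%E.
Proof.
move=> mv v0.
have mf : measurable_fun setT (fun x : R => (relu (h + x) * v x)%:E).
  apply/measurable_EFinP; apply: measurable_funM => //.
  by apply: (measurableT_comp (@measurable_relu R)); exact: measurable_funD.
have f0 x : (0 <= (relu (h + x) * v x)%:E)%E.
  by rewrite lee_fin mulr_ge0// relu_ge0.
have mN : measurable_fun [set: R] (-%R : R -> R) by [].
rewrite -(ge0_integral_gaussN mf)// ge0_integral_normal_prob//; last first.
  exact: (measurableT_comp mf).
rewrite [RHS]integral_mkcond; apply: eq_integral => x _.
rewrite patchE; case: ifPn; rewrite ?inE ?notin_setE /= in_itv/= -EFinM.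
  by move=> xh; rewrite /relu max_r ?subr_ge0.
move=> /negP; rewrite -ltNge => hx.
by rewrite /relu max_l ?mul0r// subr_le0 ltW.
Qed.

Lemma is_derive_affine (R : realType) (a b x : R) :
  is_derive x 1 (fun t : R => a + b * t) b.
Proof. by apply: is_derive_eq; rewrite add0r mul1r /GRing.scale/= mulr1. Qed.

(** The standardised form of [normal_pdf_exchange], with both sides multiplied by [c]. *)
Lemma gauss_pdf_exchange (R : realType) (r c x y : R) :
  0 < c -> r ^+ 2 + c ^+ 2 = 1 ->
  normal_pdf 0 1 x * normal_pdf 0 1 ((y - r * x) / c) =
  normal_pdf 0 1 y * normal_pdf 0 1 ((x - r * y) / c).
Proof.
move=> c0 rc; have scaled (m z : R) :
    normal_pdf 0 1 ((z - m) / c) = normal_pdf m c z * c.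
  rewrite -(@normal_pdf_affine _ m c)//; congr (normal_pdf _ _ _ * _).
  by rewrite mulrCA mulfV ?gt_eqF// mulr1 addrC subrK.
by rewrite !scaled !mulrA ![normal_pdf 0 1 _ * _]mulrC normal_pdf_exchange.
Qed.

Lemma is_derive_comp_affine (R : realType) (u : R -> R) (du a b x : R) :
  is_derive (a + b * x) 1 u du ->
  is_derive x 1 (fun t => u (a + b * t)) (du * b).
Proof.
move=> d; exact: (@is_derive1_comp _ u (fun t => a + b * t) x du b d
  (is_derive_affine a b x)).
Qed.

(** The density itself serves as primitive: [phi'(x) = (h - x) phi(x) - h phi(x)]. *)
Lemma integral_gauss_relu (R : realType) (h : R) :
  (\int[gauss]_x (relu (h + x))%:E =
   (h * gauss_cdf h + normal_pdf 0 1 h)%:E)%E.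
Proof.
transitivity (\int[gauss]_x (relu (h + x)%R * (cst 1%R x))%:E)%E.
  by apply: eq_integral => x _; rewrite mulr1.
rewrite ge0_integral_gauss_relu//.
apply: ge0_integral_Nyc_primitive (integral_gauss_pdf_ray h).
- move=> x; apply: cvgM; last exact: continuous_gauss_pdf.
  by apply: cvgM; [apply: cvgB; [exact: cvg_cst|exact: cvg_id]|exact: cvg_cst].
- exact: continuous_gauss_pdf.
- by move=> x xh; rewrite mulr1 mulr_ge0 ?subr_ge0 ?normal_pdf_ge0.
- by move=> x; exact: normal_pdf_ge0.
- move=> x; apply: (is_derive_eq (is_derive_gauss_pdf x)); rewrite /=; ring.
- exact: cvgNy_gauss_pdf.
Qed.

(** The quantity is the mean of [relu (h + X)]; it gives the sign of the conditional means below. *)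
Lemma gauss_relu_mean_ge0 (R : realType) (h : R) :
  0 <= h * gauss_cdf h + normal_pdf 0 1 h.
Proof.
rewrite -lee_fin -integral_gauss_relu integral_ge0// => x _.
by rewrite lee_fin relu_ge0.
Qed.

Lemma integral_gauss_relu_affine (R : realType) (m c : R) : 0 < c ->
  (\int[gauss]_x (relu (m + c * x))%:E =
   (m * gauss_cdf (m / c) + c * normal_pdf 0 1 (m / c))%:E)%E.
Proof.
move=> c0; transitivity (c%:E * \int[gauss]_x (relu (m / c + x)%R)%:E)%E.
  rewrite -ge0_integralZl//.
  - apply: eq_integral => x _; rewrite -EFinM -reluM ?ltW// mulrDr.
    by rewrite mulrCA mulfV ?gt_eqF// mulr1.
  - apply/measurable_EFinP; apply: (measurableT_comp (@measurable_relu R)).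
    exact: measurable_funD.
  - by move=> x _; rewrite lee_fin relu_ge0.
  - by rewrite lee_fin ltW.
rewrite integral_gauss_relu -EFinM; congr EFin.
by field; rewrite gt_eqF.
Qed.

(** * Product moment of a non-degenerate pair *)

Section correlated.
Variables (R : realType) (r c h k : R).
Hypotheses (c0 : 0 < c) (rc : r ^+ 2 + c ^+ 2 = 1).

(** [a + b t] is [(k - r t) / c], and the last argument in [A] is [(t - r k) / c]; the affine shape
    suits [is_derive_comp_affine]. *)
Let a := k / c.
Let b := - r / c.
Let P (t : R) := gauss_cdf (a + b * t).
Let p (t : R) := normal_pdf 0 1 (a + b * t).
Let f (t : R) := normal_pdf 0 1 t.
Let A (t : R) := f t * (P t * (h * r + k + - r * t)) + c * (f t * p t) +
  h * f k * gauss_cdf (- r * k / c + c^-1 * t).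

Lemma is_derive_correlated_primitive (t : R) :
  is_derive t 1 A
    ((h - t) * ((k - r * t) * P t + c * p t) * f t - (h * k + r) * (f t * P t)).
Proof.
have cn0 : c != 0 by rewrite gt_eqF.
have dP := is_derive_comp_affine (is_derive_gauss_cdf (a + b * t)).
have dp := is_derive_comp_affine (is_derive_gauss_pdf (a + b * t)).
have df := is_derive_gauss_pdf t.
have dl := is_derive_affine (h * r + k) (- r) t.
have dL := is_derive_comp_affine
  (is_derive_gauss_cdf (- r * k / c + c^-1 * t)).
have dA := is_deriveD (is_deriveD (is_deriveM df (is_deriveM dP dl))
   (is_deriveZ c (is_deriveM df dp))) (is_deriveZ (h * f k) dL).
apply: (is_derive_eq dA); rewrite /GRing.scale/= {dA dP dp df dl dL}.
(* The exchange identity expresses the derivative of the last term of [A] by [f t * p t], which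
   occurs in the other terms. *)
have exch : f k * normal_pdf 0 1 (- r * k / c + c^-1 * t) = f t * p t.
  rewrite /f /p (_ : a + b * t = (k - r * t) / c); last by rewrite /a /b; field.
  rewrite gauss_pdf_exchange//; congr (_ * normal_pdf _ _ _); field.
  exact: cn0.
rewrite -/(f t) -/(P t) -/(p t).
(* The product rule leaves a product of functions applied to [t]; it is replaced by its convertible
   value. *)
rewrite [X in X * (- t * f t)](_ : _ = P t * (h * r + k + - r * t))//.
(* Writing [1] as [r ^+ 2 + c ^+ 2] leaves an identity valid for all [r] and all nonzero [c]. *)
have -> : h * f k * (normal_pdf 0 1 (- r * k / c + c^-1 * t) / c) =
    h * (f t * p t) * ((r ^+ 2 + c ^+ 2) / c) by rewrite -exch rc; field.
by rewrite /a /b; move: (f t) (P t) (p t) => u v w; field.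
Qed.

(** Each term is built from bounded factors times [phi(t)], [t phi(t)] or [Phi((t - r k) / c)],
    which tend to 0. *)
Lemma cvgNy_correlated_primitive : A t @[t --> -oo] --> 0.
Proof.
rewrite -[X in _ --> X](addr0 0) -{1}(addr0 0).
have P1 t : `|P t| <= 1.
  by rewrite ger0_norm ?gauss_cdf_ge0 ?gauss_cdf_le1.
apply: cvgD; [apply: cvgD|].
- have -> : (fun t => f t * (P t * (h * r + k + - r * t))) =
      (fun t => f t * ((h * r + k) * P t) + (t * f t) * (- r * P t)).
    by apply/funext => t; ring.
  rewrite -[X in _ --> X](addr0 0); apply: cvgD.
    apply: (@cvg0_mul_bounded _ _ _ _ `|h * r + k|).
      by move=> t; rewrite normrM ler_piMr.
    exact: cvgNy_gauss_pdf.
  apply: (@cvg0_mul_bounded _ _ _ _ `|- r|).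
    by move=> t; rewrite normrM ler_piMr.
  exact: cvgNy_mul_gauss_pdf.
- rewrite -[X in _ --> X](mulr0 c); apply: cvgMr.
  apply: (@cvg0_mul_bounded _ _ _ _ (normal_peak 1)).
    by move=> t; rewrite ger0_norm ?normal_pdf_ge0 ?normal_pdf_ub.
  exact: cvgNy_gauss_pdf.
- rewrite -[X in _ --> X](mulr0 (h * f k)); apply: cvgMr.
  apply: (cvg_comp _ _ _ (@cvgNy_gauss_cdf R)).
  apply/cvgrNyPle => y; near=> t.
  by rewrite -lerBrDl -ler_pdivlMl ?invr_gt0.
Unshelve. all: by end_near. Qed.

Lemma integral_correlated_relu :
  (\int[leb]_(x in `]-oo, h])
     ((h - x) * ((k - r * x) * P x + c * p x) * f x)%:E =
   ((h * k + r) * fine (\int[leb]_(x in `]-oo, h]) (f x * P x)%:E)%E +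
    A h)%:E)%E.
Proof.
have cab : continuous (fun t : R => a + b * t).
  by move=> t; apply: cvgD; [exact: cvg_cst|apply: cvgMr; exact: cvg_id].
have cP : continuous P.
  move=> t; exact: (continuous_comp (cab t) (@continuous_gauss_cdf R _)).
have cp : continuous p.
  move=> t; exact: (continuous_comp (cab t) (@continuous_gauss_pdf R _)).
have P01 t : 0 <= P t <= 1 by rewrite gauss_cdf_ge0 gauss_cdf_le1.
apply: (@ge0_integral_Nyc_primitive R
  (fun x => (h - x) * ((k - r * x) * P x + c * p x) * f x)
  (fun x => f x * P x) A (h * k + r)).
- move=> t; apply: cvgM; last exact: continuous_gauss_pdf.
  apply: cvgM; first by apply: cvgB; [exact: cvg_cst|exact: cvg_id].
  apply: cvgD; last by apply: cvgMr; exact: cp.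
  apply: cvgM; last exact: cP.
  by apply: cvgB; [exact: cvg_cst|apply: cvgMr; exact: cvg_id].
- by move=> t; apply: cvgM; [exact: continuous_gauss_pdf|exact: cP].
- move=> x xh; rewrite !mulr_ge0 ?subr_ge0 ?normal_pdf_ge0//.
  (* The conditional mean is [c] times a standardised rectified mean, hence nonnegative. *)
  have -> : (k - r * x) * P x + c * p x = c * ((a + b * x) * P x + p x).
    by rewrite /a /b; field; rewrite gt_eqF.
  by rewrite mulr_ge0 ?gauss_relu_mean_ge0 ?ltW.
- by move=> x; rewrite mulr_ge0 ?normal_pdf_ge0 ?gauss_cdf_ge0.
- exact: is_derive_correlated_primitive.
- exact: cvgNy_correlated_primitive.
- rewrite fineK//; apply: integrable_fin_num => //.
  exact: integrable_gauss_weight.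
Qed.

Lemma ge0_integral_correlated_relu :
  (\int[std_normal2]_z
     (relu (h + z.1)%R * relu (k + (r * z.1 + c * z.2))%R)%:E =
   ((h * k + r) * fine (\int[leb]_(x in `]-oo, h])
      (normal_pdf 0 1 x * gauss_cdf ((k - r * x) / c))%:E)%E +
    k * (normal_pdf 0 1 h * gauss_cdf ((k - r * h) / c)) +
    h * (normal_pdf 0 1 k * gauss_cdf ((h - r * k) / c)) +
    c * (normal_pdf 0 1 h * normal_pdf 0 1 ((k - r * h) / c)))%:E)%E.
Proof.
have cn0 : c != 0 by rewrite gt_eqF.
have abE x : a + b * x = (k - r * x) / c by rewrite /a /b; field.
(* The conditional mean of the second factor given [x]; [r] has the sign opposite to that in [P] and
   [p] because the reflection comes later. *)
pose v (x : R) := (k + r * x) * gauss_cdf ((k + r * x) / c) +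
  c * normal_pdf 0 1 ((k + r * x) / c).
have mkr : measurable_fun [set: R] (fun x => k + r * x).
  by apply: measurable_funD => //; exact: measurable_funM.
have mkrc : measurable_fun [set: R] (fun x => (k + r * x) / c).
  exact: measurable_funM.
have mv : measurable_fun setT v.
  apply: measurable_funD; apply: measurable_funM => //.
    apply: measurableT_comp mkrc.
    by apply: continuous_measurable_fun; exact: continuous_gauss_cdf.
  by apply: measurableT_comp mkrc; exact: measurable_normal_pdf.
have v0 x : 0 <= v x.
  have -> : v x = c * ((k + r * x) / c * gauss_cdf ((k + r * x) / c) +
      normal_pdf 0 1 ((k + r * x) / c)) by rewrite /v; field.
  by rewrite mulr_ge0 ?gauss_relu_mean_ge0 ?ltW.
rewrite ge0_integral_std_normal2; last 2 first.
- apply/measurable_EFinP; apply: measurable_funM.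
    apply: (measurableT_comp (@measurable_relu R)).
    exact: measurable_funD.
  apply: (measurableT_comp (@measurable_relu R)).
  apply: measurable_funD => //; apply: measurable_funD; exact: measurable_funM.
- by move=> z; rewrite lee_fin mulr_ge0 ?relu_ge0.
transitivity (\int[gauss]_x (relu (h + x)%R * v x)%:E)%E.
  apply: eq_integral => x _ /=.
  under eq_integral do rewrite EFinM addrA.
  rewrite ge0_integralZl//; last 3 first.
  - apply/measurable_EFinP; apply: (measurableT_comp (@measurable_relu R)).
    by apply: measurable_funD => //; exact: measurable_funM.
  - by move=> y _; rewrite lee_fin relu_ge0.
  - by rewrite lee_fin relu_ge0.
  by rewrite integral_gauss_relu_affine.
rewrite ge0_integral_gauss_relu//.
transitivity (\int[leb]_(x in `]-oo, h])
     ((h - x) * ((k - r * x) * P x + c * p x) * f x)%:E)%E.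
  by apply: eq_integral => x _; rewrite /v /P /p abE mulrN.
rewrite integral_correlated_relu; congr EFin.
rewrite /A /P /p /f abE.
rewrite (_ : - r * k / c + c^-1 * h = (h - r * k) / c); last by field.
under eq_integral do rewrite abE.
ring.
Qed.

End correlated.

(** * The bivariate distribution function and its derivatives *)

Lemma le_gauss_cdf (R : realType) (x y : R) :
  x <= y -> gauss_cdf x <= gauss_cdf y.
Proof.
move=> xy; rewrite -lee_fin -!gauss_cdfE.
apply: (@le_measure _ _ _ (normal_prob 0 1)); rewrite ?inE//.
by move=> z /=; rewrite !in_itv/= => /le_trans; apply.
Qed.

(** [gauss_cdf] is monotone, so on each side of [a] the function is locally
    [gauss_cdf - gauss_cdf a] or 0. The degenerate [Phi2] is expressed through it. *)
Lemma is_derive_relu_cdf (R : realType) (a x : R) : x != a ->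
  is_derive x 1 (fun t => relu (gauss_cdf t - gauss_cdf a))
    (if a < x then normal_pdf 0 1 x else 0).
Proof.
move=> xa; case: ifPn => [ax|]; last rewrite -leNgt => ax.
- apply: (@near_eq_is_derive _ _ _ (fun t => gauss_cdf t - gauss_cdf a)).
    near=> t; rewrite /relu max_r// subr_ge0 le_gauss_cdf// ltW//.
    near: t; exact: lt_nbhsr.
  have d := is_deriveB (is_derive_gauss_cdf x)
    (is_derive_cst (gauss_cdf a) x 1).
  by apply: (is_derive_eq d); rewrite subr0.
- apply: (@near_eq_is_derive _ _ _ (cst 0)).
  near=> t; rewrite /relu max_l// subr_le0 le_gauss_cdf// ltW//.
  by near: t; apply: lt_nbhsl; rewrite lt_neqAle xa.
Unshelve. all: by end_near. Qed.

(* Both [relu u] and [relu u - u] are minimal where [u] vanishes, so a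
   derivative there would force [u' = 0]. *)
Lemma not_derivable_relu_cdf (R : realType) (a : R) :
  ~ derivable (fun t => relu (gauss_cdf t - gauss_cdf a)) a 1.
Proof.
pose u (t : R) : R := gauss_cdf t - gauss_cdf a; pose ru (t : R) := relu (u t).
rewrite -/(u _) => da.
have dru (t : R) : derivable ru t 1.
  have [->//|ta] := eqVneq t a.
  by have [] := is_derive_relu_cdf ta.
have du (t : R) : is_derive t 1 u (normal_pdf 0 1 t).
  have d := is_deriveB (is_derive_gauss_cdf t)
    (is_derive_cst (gauss_cdf a) t 1).
  by apply: (is_derive_eq d); rewrite subr0.
have dd (t : R) : derivable (ru - u) t 1 
  by have [dut _] := du t; exact: (derivableB (dru t) dut).
have ua : u a = 0 by rewrite /u subrr.
have rua : ru a = 0 by rewrite /ru ua /relu maxxx.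
have a1 : a - 1 <= a + 1 by lra.
have aa : a \in `](a - 1), (a + 1)[ by rewrite in_itv/=; apply/andP; split; lra.
have m1 t : ru a <= ru t by rewrite rua /ru relu_ge0.
have m2 t : (ru - u) a <= (ru - u) t.
  by rewrite !fctE rua ua subr0 subr_ge0 /ru /relu le_max lexx orbT.
have [_ e1] := derive1_at_min a1 (fun t _ => dru t) aa (fun t _ => m1 t).
have [_ e2] := derive1_at_min a1 (fun t _ => dd t) aa (fun t _ => m2 t).
have [dua u'a] := du a.
move: e2; rewrite (deriveB (dru a) dua) e1 u'a sub0r => /eqP.
by rewrite oppr_eq0 gt_eqF// gauss_pdf_gt0.
Qed.

Lemma std_normal2_fst (R : realType) (A : set R) : measurable A ->
  (std_normal2 [set z : R * R | A z.1] = gauss A)%E.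
Proof.
move=> mA; rewrite (_ : [set z | A z.1] = A `*` setT); last first.
  by apply/seteqP; split => z //= [].
rewrite /std_normal2 /= product_measure1E//.
by rewrite [X in (_ * X)%E](@probability_setT _ _ _ (normal_prob 0 1)) mule1.
Qed.

Lemma Phi2_sqrtE (R : realType) (h k r : R) : Phi2 h k r =
  fine (std_normal2 [set z : R * R |
    z.1 <= h /\ r * z.1 + Num.sqrt (1 - r ^+ 2) * z.2 <= k]).
Proof.
rewrite /Phi2 (_ : [set z | _ <= h /\ _] = [set z : R * R |
    z.1 <= h /\ r * z.1 + Num.sqrt (1 - r ^+ 2) * z.2 <= k]) //.
by apply/funext => z /=; rewrite /gauss1 /gauss2 sqrtr1 !divr1 mul1r !add0r.
Qed.

(** Both coordinates are [z.1], so the event is [z.1 <= min h k]; the [relu] form isolates the kink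
    on [h = k]. *)
Lemma Phi2_one (R : realType) (h k : R) :
  Phi2 h k 1 = gauss_cdf h - relu (gauss_cdf h - gauss_cdf k).
Proof.
rewrite Phi2_sqrtE.
rewrite (_ : [set _ | _] =
    [set z | [set` `]-oo, Num.min h k]] z.1]); last first.
  apply/funext => z /=; rewrite expr1n subrr sqrtr0 mul0r addr0 mul1r in_itv/=.
  by rewrite le_min; apply/propext; split => [[-> ->]//|/andP].
rewrite std_normal2_fst; last exact: measurable_itv.
rewrite gauss_cdfE /= /relu; have [hk|kh] := leP h k.
  by rewrite max_l ?subr0// subr_le0 le_gauss_cdf.
by rewrite max_r ?subKr// subr_ge0 le_gauss_cdf// ltW.
Qed.

Lemma gauss_itvE (R : realType) (a b : R) : a <= b ->
  (gauss [set` `[a, b]] = (gauss_cdf b - gauss_cdf a)%:E)%E.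
Proof.
rewrite le_eqVlt => /predU1P[->|ab].
  by rewrite set_itv1 /normal_prob integral_set1 subrr.
(* With [q = 0] and [g = 0], [integral_itv_primitive] is the plain fundamental theorem. *)
have dA (x : R) : is_derive x 1 (@gauss_cdf R) (normal_pdf 0 1 x - 0 * cst 0 x).
  by apply: (is_derive_eq (is_derive_gauss_cdf x)); rewrite mul0r subr0.
rewrite /normal_prob (integral_itv_primitive ab (@continuous_gauss_pdf R) _ dA).
  by rewrite mul0r add0r.
by move=> x; exact: cvg_cst.
Qed.

(** The second coordinate is [- z.1], so the event is [- k <= z.1 <= h], empty when [h < - k]. *)
Lemma Phi2_minus_one (R : realType) (h k : R) :
  Phi2 h k (-1) = relu (gauss_cdf h - gauss_cdf (- k)).
Proof.
rewrite Phi2_sqrtE.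
rewrite (_ : [set _ | _] = [set z | [set` `[- k, h]] z.1]); last first.
  apply/funext => z /=.
  rewrite sqrrN expr1n subrr sqrtr0 mul0r addr0 mulN1r in_itv/=.
  by rewrite lerNl; apply/propext; split => [[-> ->]//|/andP[]].
rewrite std_normal2_fst; last exact: measurable_itv.
have [kh|hk] := leP (- k) h.
  by rewrite gauss_itvE//= /relu max_r// subr_ge0 le_gauss_cdf.
rewrite set_itv_ge ?measure0 /relu ?max_l// ?subr_le0 ?le_gauss_cdf ?ltW//.
by rewrite bnd_simp -ltNge.
Qed.

(** * The distribution function for correlation strictly between -1 and 1 *)

Section Phi2_regular.
Variables (R : realType) (r : R).
Hypothesis r1 : r ^+ 2 < 1.

Let c : R := Num.sqrt (1 - r ^+ 2).

Lemma sqrt_compl_gt0 : 0 < c.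
Proof. by rewrite sqrtr_gt0 subr_gt0. Qed.

Lemma sqr_sqrt_compl : r ^+ 2 + c ^+ 2 = 1.
Proof. by rewrite sqr_sqrtr ?subr_ge0 ?ltW// subrKC. Qed.

Let quadrant (h k : R) : set (R * R) := [set` `]-oo, h]] `*` [set` `]-oo, k]].

Let measurable_quadrant h k : measurable (quadrant h k).
Proof. by apply: measurableX; exact: measurable_itv. Qed.

(** As the integral of an indicator, [Phi2] falls under the changes of variables for nonnegative
    functions. *)
Let g h k (z : R * R) : \bar R := (\1_(quadrant h k) z)%:E.

Let mg h k : measurable_fun setT (g h k).
Proof. by apply/measurable_EFinP; exact: measurable_indic. Qed.

Let g0 h k z : (0 <= g h k z)%E.
Proof. by rewrite lee_fin. Qed.

Let Phi2_indic h k : Phi2 h k r =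
  fine (\int[std_normal2]_z g h k (z.1, r * z.1 + c * z.2)%R)%E.
Proof.
rewrite Phi2_sqrtE -/c; congr fine.
pose pair (z : R * R) : R * R := (z.1, r * z.1 + c * z.2).
rewrite (_ : [set _ | _] = pair @^-1` quadrant h k); last first.
  by apply/funext => z; rewrite /quadrant /pair /= !in_itv.
have mpair : measurable_fun setT pair.
  exact: (@measurable_gauss_pair _ _ _ id r c (@measurable_id _ _ setT)).
have mpre : measurable (pair @^-1` quadrant h k).
  by rewrite -[X in measurable X]setTI; exact: mpair.
transitivity (\int[std_normal2]_z (\1_(pair @^-1` quadrant h k) z)%:E)%E.
  have ii := integral_indic std_normal2 measurableT mpre.
  by rewrite setIT in ii; exact: (esym ii).
by apply: eq_integral => z _.
Qed.

(** Exchangeability of the pair; it turns the derivative in the second argument, as in [phi2], into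
    one in the first. *)
Lemma Phi2C (h k : R) : Phi2 h k r = Phi2 k h r.
Proof.
rewrite !Phi2_indic; congr fine.
rewrite (ge0_integral_gauss_pair_swap sqrt_compl_gt0 sqr_sqrt_compl)//.
apply: eq_integral => z _; rewrite /g !indicE; congr ((nat_of_bool _)%:R%:E).
by apply/idP/idP; rewrite !inE /quadrant /= => -[].
Qed.

(** Given [z.1 = x], the condition [r x + c z.2 <= k] has probability [Phi((k - r x) / c)]. *)
Lemma Phi2_conditional (h k : R) : Phi2 h k r =
  fine (\int[leb]_(x in `]-oo, h])
    (normal_pdf 0 1 x * gauss_cdf ((k - r * x) / c))%:E)%E.
Proof.
have c0 := sqrt_compl_gt0; have cn0 : c != 0 by rewrite gt_eqF.
rewrite Phi2_indic; congr fine.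
rewrite ge0_integral_std_normal2; last 2 first.
- exact: measurable_gauss_pair.
- by move=> z; exact: g0.
have mcdf : measurable_fun [set: R] (fun x => gauss_cdf ((k - r * x) / c)).
  apply: (measurableT_comp (f := @gauss_cdf R)).
    by apply: continuous_measurable_fun; exact: continuous_gauss_cdf.
  by apply: measurable_funM => //; apply: measurable_funB => //.
transitivity (\int[gauss]_x
   (\1_[set` `]-oo, h]] x * gauss_cdf ((k - r * x) / c))%:E)%E.
  apply: eq_integral => x _.
  transitivity (\int[gauss]_y ((\1_[set` `]-oo, h]] x)%:E *
      (\1_[set` `]-oo, k]] (r * x + c * y)%R)%:E))%E.
    apply: eq_integral => y _; rewrite /g /= -EFinM !indicE -natrM mulnb.
    by congr ((nat_of_bool _)%:R%:E); apply/idP/andP; rewrite !inE.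
  have mray : measurable_fun [set: R] 
      (fun y : R => (\1_[set` `]-oo, k]] y : R)%:E).
    by apply/measurable_EFinP; apply: measurable_indic; exact: measurable_itv.
  have maff : measurable_fun [set: R] (fun y => r * x + c * y).
    by apply: measurable_funD => //; exact: measurable_funM.
  rewrite ge0_integralZl//; last exact: (measurableT_comp mray maff).
  rewrite EFinM; congr (_ * _)%E.
  rewrite (@ge0_integral_normal_affine R (r * x) c _ c0 mray)//.
  have mk : measurable ([set` `]-oo, k]] : set R) by exact: measurable_itv.
  rewrite integral_indic// setIT.
  have kE : k = r * x + c * ((k - r * x) / c) by field.
  transitivity (normal_prob (r * x) c
      [set` `]-oo, r * x + c * ((k - r * x) / c)]]).
    by rewrite -kE.
  by rewrite normal_prob_ray_affine// gauss_cdfE.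
rewrite ge0_integral_normal_prob; last 2 first.
- apply/measurable_EFinP; apply: measurable_funM; last exact: mcdf.
  by apply: measurable_indic; exact: measurable_itv.
- by move=> x; rewrite lee_fin mulr_ge0 ?gauss_cdf_ge0.
rewrite [RHS]integral_mkcond; apply: eq_integral => x _.
rewrite patchE indicE; case: ifPn => xh; last by rewrite !mul0r mul0e.
by rewrite mul1r -EFinM mulrC.
Qed.

Let is_derive_Phi2_1 (h k : R) :
  is_derive h 1 (fun t => Phi2 t k r)
    (normal_pdf 0 1 h * gauss_cdf ((k - r * h) / c)).
Proof.
rewrite (_ : (fun t => Phi2 t k r) = (fun t => fine (\int[leb]_(x in `]-oo, t])
    (normal_pdf 0 1 x * gauss_cdf ((k - r * x) / c))%:E)%E)); last first.
  by apply/funext => t; exact: Phi2_conditional.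
apply: is_derive_gauss_weight => [x|x]; last first.
  by rewrite gauss_cdf_ge0 gauss_cdf_le1.
apply: (continuous_comp (f := fun x => (k - r * x) / c)); last first.
  exact: continuous_gauss_cdf.
apply: cvgMl; apply: cvgB; first exact: cvg_cst.
by apply: cvgMr; exact: cvg_id.
Qed.

Lemma Phi2_1E (h k : R) :
  Phi2_1 h k r = normal_pdf 0 1 h * gauss_cdf ((k - r * h) / c).
Proof. by rewrite /Phi2_1 derive1E; have [_ ->] := is_derive_Phi2_1 h k. Qed.

Lemma phi2E (h k : R) :
  phi2 h k r = normal_pdf 0 1 h * normal_pdf 0 1 ((k - r * h) / c) / c.
Proof.
have c0 := sqrt_compl_gt0; have cn0 : c != 0 by rewrite gt_eqF.
rewrite /phi2 (_ : (fun s => _) = (fun s => normal_pdf 0 1 k *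
    gauss_cdf (- r * k / c + c^-1 * s))); last first.
  apply/funext => s.
  rewrite (_ : (fun t => Phi2 s t r) = (fun t => Phi2 t s r)).
    rewrite -/(Phi2_1 k s r) Phi2_1E; congr (_ * gauss_cdf _); field.
    exact: cn0.
  by apply/funext => t; exact: Phi2C.
have d := is_deriveZ (normal_pdf 0 1 k) (is_derive_comp_affine
  (is_derive_gauss_cdf (- r * k / c + c^-1 * h))).
rewrite derive1E; have [_ ->] := d; rewrite /GRing.scale/=.
(* Differentiation gives [phi(k) phi((h - r k) / c) / c]; the exchange identity matches it with the
   form conditioned on the first argument. *)
rewrite (gauss_pdf_exchange _ _ c0 sqr_sqrt_compl) mulrA.
by congr (_ * normal_pdf _ _ _ / _); field.
Qed.

End Phi2_regular.

(** * The product moment of a rectified pair *)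

(** The case of correlation 1. After reflection the second factor is [k - x] on all of [x <= h], and
    [phi(x) (h + k - x)] is a primitive of the integrand minus [(h k + 1) phi(x)]. *)
Lemma integral_gauss_relu_same (R : realType) (h k : R) : h <= k ->
  (\int[gauss]_x (relu (h + x) * relu (k + x))%:E =
   ((h * k + 1) * gauss_cdf h + k * normal_pdf 0 1 h)%:E)%E.
Proof.
move=> hk; rewrite (@ge0_integral_gauss_relu _ h (fun x => relu (k + x))).
- transitivity (\int[leb]_(x in `]-oo, h])
     ((h - x) * (k - x) * normal_pdf 0 1 x)%:E)%E.
    apply: eq_integral => x; rewrite inE/= in_itv/= => xh.
    by rewrite {1}/relu max_r// subr_ge0 (le_trans xh).
  pose A (x : R) := normal_pdf 0 1 x * (h + k + -1 * x).
  have -> : k * normal_pdf 0 1 h = A h by rewrite /A; ring.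
  apply: (@ge0_integral_Nyc_primitive R _ (normal_pdf 0 1) A (h * k + 1)
    (gauss_cdf h) h) (integral_gauss_pdf_ray h).
  + move=> x; apply: cvgM; last exact: continuous_gauss_pdf.
    apply: cvgM; apply: cvgB;
      [exact: cvg_cst|exact: cvg_id|exact: cvg_cst|exact: cvg_id].
  + exact: continuous_gauss_pdf.
  + move=> x xh; rewrite !mulr_ge0 ?subr_ge0 ?normal_pdf_ge0//.
    exact: le_trans hk.
  + by move=> x; exact: normal_pdf_ge0.
  + move=> x; have d := is_deriveM (is_derive_gauss_pdf x)
      (is_derive_affine (h + k) (-1) x).
    by apply: (is_derive_eq d); rewrite /GRing.scale/=; ring.
  + rewrite /A; have -> : (fun x => normal_pdf 0 1 x * (h + k + -1 * x)) =
        (fun x => normal_pdf 0 1 x * (h + k) - x * normal_pdf 0 1 x).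
      by apply/funext => x; ring.
    rewrite -[X in _ --> X](subr0 0) -[X in X - 0](mul0r (h + k)).
    apply: cvgB; last exact: cvgNy_mul_gauss_pdf.
    by apply: cvgMl; exact: cvgNy_gauss_pdf.
- apply: (measurableT_comp (@measurable_relu R)); exact: measurable_funD.
- by move=> x; exact: relu_ge0.
Qed.

(** The case of correlation -1. After reflection the integrand lives on [[- k, h]], and
    [phi(x) (k - h + x)] is a primitive of it minus [(h k - 1) phi(x)]. *)
Lemma integral_gauss_relu_opposite (R : realType) (h k : R) :
  (\int[gauss]_x (relu (h + x) * relu (k - x))%:E =
   (if - k < h then (h * k - 1) * (gauss_cdf h - gauss_cdf (- k)) +
      (k * normal_pdf 0 1 h + h * normal_pdf 0 1 k) else 0)%:E)%E.
Proof.
case: ifPn => [kh|]; last first.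
  (* For [h <= - k] one of the two factors vanishes at every point. *)
  rewrite -leNgt => hk; apply: integral0_eq => x _; congr EFin.
  have [xh|hx] := leP (h + x) 0; first by rewrite {1}/relu max_l// mul0r.
  by rewrite mulrC {1}/relu max_l ?mul0r//; lra.
rewrite (@ge0_integral_gauss_relu _ h (fun x => relu (k - x))); last 2 first.
- apply: (measurableT_comp (@measurable_relu R)); exact: measurable_funB.
- by move=> x; exact: relu_ge0.
transitivity (\int[leb]_(x in `[(- k)%R, h])
   ((h - x) * (k + x) * normal_pdf 0 1 x)%:E)%E.
  rewrite [LHS]integral_mkcond [RHS]integral_mkcond.
  apply: eq_integral => x _; rewrite !patchE opprK.
  rewrite (_ : (x \in [set` `]-oo, h]]) = (x <= h)); last first.
    by apply/idP/idP; rewrite inE/= in_itv.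
  rewrite (_ : (x \in [set` `[- k, h]]) = (- k <= x <= h)); last first.
    by apply/idP/idP; rewrite inE/= in_itv.
  have [kx|xk] := leP (- k) x => /=; case: leP => // xh; congr EFin.
    by rewrite /relu max_r//; lra.
  by rewrite /relu max_l ?mulr0 ?mul0r//; lra.
pose A (x : R) := normal_pdf 0 1 x * (k - h + 1 * x).
have cf : continuous (fun x => (h - x) * (k + x) * normal_pdf 0 1 x).
  move=> x; apply: cvgM; last exact: continuous_gauss_pdf.
  apply: cvgM; first by apply: cvgB; [exact: cvg_cst|exact: cvg_id].
  by apply: cvgD; [exact: cvg_cst|exact: cvg_id].
have dA (x : R) : is_derive x 1 A
    ((h - x) * (k + x) * normal_pdf 0 1 x - (h * k - 1) * normal_pdf 0 1 x).
  have d := is_deriveM (is_derive_gauss_pdf x) (is_derive_affine (k - h) 1 x).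
  by apply: (is_derive_eq d); rewrite /GRing.scale/=; ring.
rewrite (integral_itv_primitive kh cf (@continuous_gauss_pdf R) dA).
have -> : (fine (\int[leb]_(x in `[(- k)%R, h]) (normal_pdf 0 1 x)%:E) =
    (gauss_cdf h - gauss_cdf (- k))%R)%E.
  by have := gauss_itvE (ltW kh); rewrite /normal_prob => ->.
by congr EFin; rewrite /A gauss_pdfN; ring.
Qed.

Lemma ge0_integral_std_normal2_fst (R : realType) (f : R -> \bar R) :
  measurable_fun setT f -> (forall x, 0 <= f x)%E ->
  (\int[std_normal2]_z f z.1 = \int[gauss]_x f x)%E.
Proof.
move=> mf f0; rewrite ge0_integral_std_normal2//; last first.
  exact: (measurableT_comp mf).
apply: eq_integral => x _ /=; rewrite integral_cst//.
by rewrite [X in (_ * X)%E](@probability_setT _ _ _ (normal_prob 0 1)) mule1.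
Qed.

Lemma derivable_Phi2_one (R : realType) (h k : R) :
  Phi2_1_exists h k 1 -> h != k.
Proof.
move=> d; apply/eqP => hk; rewrite {}hk in d.
apply: (@not_derivable_relu_cdf R k).
have [d1 _] := is_derive_gauss_cdf k.
rewrite (_ : (fun t => relu _) = @gauss_cdf R - (fun t => Phi2 t k 1)).
  exact: (derivableB d1 d).
by apply/funext => t; rewrite !fctE Phi2_one subKr.
Qed.

Lemma derivable_Phi2_minus_one (R : realType) (h k : R) :
  Phi2_1_exists h k (-1) -> h != - k.
Proof.
move=> d; apply/eqP => hk; rewrite {}hk in d.
apply: (@not_derivable_relu_cdf R (- k)).
rewrite (_ : (fun t => relu _) = (fun t => Phi2 t k (-1))) //.
by apply/funext => t; rewrite Phi2_minus_one.
Qed.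

Lemma Phi2_1_one (R : realType) (h k : R) : h != k ->
  Phi2_1 h k 1 = if h < k then normal_pdf 0 1 h else 0.
Proof.
move=> hk; rewrite /Phi2_1 derive1E.
rewrite (_ : (fun t => Phi2 t k 1) =
    @gauss_cdf R - (fun t => relu (gauss_cdf t - gauss_cdf k))); last first.
  by apply/funext => t; rewrite Phi2_one.
have [_ ->] := is_deriveB (is_derive_gauss_cdf h) (is_derive_relu_cdf hk).
by case: ltgtP hk => // _ _; rewrite ?subr0 ?subrr.
Qed.

Lemma Phi2_1_minus_one (R : realType) (h k : R) : h != - k ->
  Phi2_1 h k (-1) = if - k < h then normal_pdf 0 1 h else 0.
Proof.
move=> hk; rewrite /Phi2_1 derive1E.
rewrite (_ : (fun t => Phi2 t k (-1)) =
    (fun t => relu (gauss_cdf t - gauss_cdf (- k)))); last first.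
  by apply/funext => t; rewrite Phi2_minus_one.
by have [_ ->] := is_derive_relu_cdf hk.
Qed.

(* When [r ^+ 2 = 1] the factor [1 - r ^+ 2] kills the junk value of [phi2]. *)
Lemma integral_relu_pair (R : realType) (h k r : R) : r ^+ 2 <= 1 ->
  (r ^+ 2 = 1 -> Phi2_1_exists h k r /\ Phi2_1_exists k h r) ->
  (\int[std_normal2]_z (relu (h + z.1)%R *
     relu (k + (r * z.1 + Num.sqrt (1 - r ^+ 2) * z.2))%R)%:E =
   (k * Phi2_1 h k r + h * Phi2_1 k h r + (1 - r ^+ 2) * phi2 h k r +
    (h * k + r) * Phi2 h k r)%:E)%E.
Proof.
rewrite le_eqVlt => /predU1P[r1 /(_ r1)[d1 d2]|r1 _]; last first.
  apply: etrans (ge0_integral_correlated_relu h k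
    (sqrt_compl_gt0 r1) (sqr_sqrt_compl r1)) _.
  congr EFin; rewrite !Phi2_1E// phi2E// (Phi2_conditional r1).
  have := sqr_sqrt_compl r1; have := sqrt_compl_gt0 r1.
  move: (fine _) => J.
  move: (Num.sqrt (1 - r ^+ 2)) => c c0 rc.
  (* [phi2] carries a factor [1 / c], so [(1 - r^2) phi2] is the term [c phi phi] of the
     integral. *)
  have -> : 1 - r ^+ 2 = c ^+ 2 by rewrite -rc addrC addKr.
  by field; rewrite gt_eqF.
rewrite r1 subrr sqrtr0 mul0r addr0.
under eq_integral do rewrite mul0r addr0.
have mrelu (u : R -> R) : measurable_fun setT u ->
    measurable_fun setT (fun x => relu (u x)).
  by move=> mu; exact: (measurableT_comp (@measurable_relu R)).
rewrite (@ge0_integral_std_normal2_fst R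
  (fun x => (relu (h + x)%R * relu (k + r * x)%R)%:E)); last 2 first.
- apply/measurable_EFinP; apply: measurable_funM; apply: mrelu.
    exact: measurable_funD.
  by apply: measurable_funD => //; exact: measurable_funM.
- by move=> x; rewrite lee_fin mulr_ge0// relu_ge0.
move/eqP: r1; rewrite sqrf_eq1 => /orP[] /eqP r1; rewrite {}r1 in d1 d2 *.
- have hk := derivable_Phi2_one d1.
  rewrite !Phi2_1_one// 1?eq_sym// Phi2_one.
  under eq_integral do rewrite mul1r.
  case: ltgtP hk => // hk _.
  + rewrite integral_gauss_relu_same ?ltW//; congr EFin.
    by rewrite /relu max_l ?subr_le0 ?le_gauss_cdf ?ltW//; ring.
  (* Here [k < h]: the factors are swapped to put the smaller shift first. *)
  + under eq_integral do rewrite mulrC.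
    rewrite integral_gauss_relu_same ?ltW//; congr EFin.
    by rewrite /relu max_r ?subr_ge0 ?le_gauss_cdf ?ltW//; ring.
- have hk := derivable_Phi2_minus_one d1.
  have kh := derivable_Phi2_minus_one d2.
  rewrite !Phi2_1_minus_one// Phi2_minus_one.
  under eq_integral do rewrite mulN1r.
  rewrite integral_gauss_relu_opposite; congr EFin.
  (* The conditions governing the two partial derivatives coincide, so one case distinction decides
     all terms. *)
  rewrite (_ : (- h < k) = (- k < h)); last by rewrite ltrNl.
  case: ifPn => [lt|].
    by rewrite /relu max_r ?subr_ge0 ?le_gauss_cdf ?ltW//; ring.
  rewrite -leNgt => hk'; rewrite /relu max_l ?subr_le0 ?le_gauss_cdf//.
  ring.
Qed.

(** * Marginal means, integrability and the covariance *)

Lemma integral_std_normal2_marginal (R : realType) (k r : R) : r ^+ 2 <= 1 ->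
  (\int[std_normal2]_z
     (relu (k + (r * z.1 + Num.sqrt (1 - r ^+ 2) * z.2))%R)%:E =
   \int[gauss]_x (relu (k + x))%:E)%E.
Proof.
have mrelu : measurable_fun setT (fun x => (relu (k + x))%:E).
  apply/measurable_EFinP; apply: (measurableT_comp (@measurable_relu R)).
  exact: measurable_funD.
have relu0 x : (0 <= (relu (k + x))%:E)%E by rewrite lee_fin relu_ge0.
rewrite le_eqVlt => /predU1P[r1|r1].
  rewrite r1 subrr sqrtr0; under eq_integral do rewrite mul0r addr0.
  move/eqP: r1; rewrite sqrf_eq1 => /orP[] /eqP ->.
    by under eq_integral do rewrite mul1r; exact: ge0_integral_std_normal2_fst.
  under eq_integral do rewrite mulN1r.
  rewrite -(ge0_integral_gaussN mrelu relu0).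
  rewrite (@ge0_integral_std_normal2_fst R (fun x => (relu (k - x))%:E))//.
  exact: (measurableT_comp mrelu).
have m2 : measurable_fun setT (fun z : R * R => (relu (k + z.2))%:E).
  exact: (measurableT_comp mrelu).
(* Exchanging the coordinates leaves a function of the first one alone. *)
rewrite (@ge0_integral_gauss_pair_swap R r (Num.sqrt (1 - r ^+ 2))
  (fun z => (relu (k + z.2))%:E)) ?sqrt_compl_gt0 ?sqr_sqrt_compl//.
exact: ge0_integral_std_normal2_fst.
Qed.

Lemma Msigma_reluE (R : realType) (m v : R) : 0 < v ->
  Msigma relu m v = Num.sqrt v *
    (m / Num.sqrt v * gauss_cdf (m / Num.sqrt v) +
     normal_pdf 0 1 (m / Num.sqrt v)).
Proof.
move=> v0; have s0 : 0 < Num.sqrt v by rewrite sqrtr_gt0.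
have mrelu : measurable_fun setT (fun x : R => (relu x)%:E).
  by apply/measurable_EFinP; exact: measurable_relu.
rewrite /Msigma /normal_law gt_eqF// unlock.
rewrite -(ge0_integral_normal_affine m s0 mrelu); last first.
  by move=> x; rewrite lee_fin relu_ge0.
rewrite integral_gauss_relu_affine//=.
by field; rewrite gt_eqF.
Qed.

(** The covariance identities ask for integrability of both factors and of their product; for
    nonnegative functions a finite integral suffices. *)
Lemma ge0_integral_Lfun1 (R : realType) (X : R * R -> R) (x : R) :
  measurable_fun setT X -> (forall z, 0 <= X z) ->
  (\int[std_normal2]_z (X z)%:E = x%:E)%E ->
  X \in Lfun std_normal2 1.
Proof.
move=> mX X0 EX; apply/Lfun1_integrable; apply/integrableP; split.
  exact/measurable_EFinP.
under eq_integral => z _ do rewrite /= ger0_norm//.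
by rewrite EX ltry.
Qed.

Theorem lemmaE2 (R : realType) (mu1 mu2 nu11 nu22 nu12 : R)
    (nu11_gt0 : 0 < nu11) (nu22_gt0 : 0 < nu22)
    (nu_psd : nu12 ^+ 2 <= nu11 * nu22)
    (nu_sing : nu12 ^+ 2 = nu11 * nu22 ->
       Phi2_1_exists (mu1 / Num.sqrt nu11) (mu2 / Num.sqrt nu22)
         (nu12 / Num.sqrt (nu11 * nu22)) /\
       Phi2_1_exists (mu2 / Num.sqrt nu22) (mu1 / Num.sqrt nu11)
         (nu12 / Num.sqrt (nu11 * nu22))) :
  Ksigma relu mu1 mu2 nu11 nu22 nu12 =
    mu2 * Num.sqrt nu11 *
      Phi2_1 (mu1 / Num.sqrt nu11) (mu2 / Num.sqrt nu22)
        (nu12 / Num.sqrt (nu11 * nu22))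
    + mu1 * Num.sqrt nu22 *
      Phi2_1 (mu2 / Num.sqrt nu22) (mu1 / Num.sqrt nu11)
        (nu12 / Num.sqrt (nu11 * nu22))
    + (Num.sqrt (nu11 * nu22) - nu12 ^+ 2 / Num.sqrt (nu11 * nu22)) *
      phi2 (mu1 / Num.sqrt nu11) (mu2 / Num.sqrt nu22)
        (nu12 / Num.sqrt (nu11 * nu22))
    + (mu1 * mu2 + nu12) *
      Phi2 (mu1 / Num.sqrt nu11) (mu2 / Num.sqrt nu22)
        (nu12 / Num.sqrt (nu11 * nu22))
    - Msigma relu mu1 nu11 * Msigma relu mu2 nu22.
Proof.
rewrite !Msigma_reluE//.
have s1_gt0 : 0 < Num.sqrt nu11 by rewrite sqrtr_gt0.
have s2_gt0 : 0 < Num.sqrt nu22 by rewrite sqrtr_gt0.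
have s1E : Num.sqrt nu11 ^+ 2 = nu11 by rewrite sqr_sqrtr// ltW.
have s2E : Num.sqrt nu22 ^+ 2 = nu22 by rewrite sqr_sqrtr// ltW.
have s12E : Num.sqrt (nu11 * nu22) = Num.sqrt nu11 * Num.sqrt nu22.
  by rewrite sqrtrM// ltW.
rewrite /Ksigma; move: s1_gt0 s2_gt0 s1E s2E nu_psd nu_sing; rewrite {}s12E.
rewrite /gauss1 /gauss2.
(* The square roots become positive atoms whose squares are the variances; the other data are then
   expressed by [h], [k] and [r]. *)
move: (Num.sqrt nu11) (Num.sqrt nu22) => s1 s2 s1_gt0 s2_gt0 s1E s2E.
have s1n0 : s1 != 0 by rewrite gt_eqF.
have s2n0 : s2 != 0 by rewrite gt_eqF.
set h := mu1 / s1; set k := mu2 / s2; set r := nu12 / (s1 * s2).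
have nu12E : nu12 = s1 * s2 * r by rewrite /r; field; rewrite s1n0 s2n0.
have mu1E : mu1 = s1 * h by rewrite /h; field.
have mu2E : mu2 = s2 * k by rewrite /k; field.
rewrite -s1E -s2E => psd sing.
have r1 : r ^+ 2 <= 1.
  rewrite /r expr_div_n ler_pdivrMr ?exprn_gt0 ?mulr_gt0//.
  by rewrite mul1r exprMn.
clearbody h k r.
(* [r ^+ 2 = 1] means that the covariance matrix is singular, where the differentiability hypothesis
   applies. *)
have r1E : r ^+ 2 = 1 -> Phi2_1_exists h k r /\ Phi2_1_exists k h r.
  by move=> rr; apply: sing; rewrite nu12E !exprMn rr mulr1.
set c := Num.sqrt (1 - r ^+ 2).
(* The conditional standard deviation is [s2] times that of the standardised pair. *)
have cE : Num.sqrt (s2 ^+ 2 - nu12 ^+ 2 / s1 ^+ 2) = s2 * c.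
  rewrite (_ : s2 ^+ 2 - _ = s2 ^+ 2 * (1 - r ^+ 2)); last first.
    by rewrite nu12E; field.
  by rewrite sqrtrM ?sqr_ge0// sqrtr_sqr gtr0_norm.
pose X1 (z : R * R) := relu (h + z.1).
pose X2 (z : R * R) := relu (k + (r * z.1 + c * z.2)).
have mX1 : measurable_fun setT X1.
  by apply: (measurableT_comp (@measurable_relu R)); exact: measurable_funD.
have mX2 : measurable_fun setT X2.
  apply: (measurableT_comp (@measurable_relu R)); apply: measurable_funD => //.
  by apply: measurable_funD; exact: measurable_funM.
have X1_ge0 z : 0 <= X1 z by exact: relu_ge0.
have X2_ge0 z : 0 <= X2 z by exact: relu_ge0.
have E1 : (\int[std_normal2]_z (X1 z)%:E =
    (h * gauss_cdf h + normal_pdf 0 1 h)%:E)%E.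
  rewrite -integral_gauss_relu.
  apply: (@ge0_integral_std_normal2_fst R (fun x => (relu (h + x))%:E)).
    apply/measurable_EFinP; apply: (measurableT_comp (@measurable_relu R)).
    exact: measurable_funD.
  by move=> x; rewrite lee_fin relu_ge0.
have E2 : (\int[std_normal2]_z (X2 z)%:E =
    (k * gauss_cdf k + normal_pdf 0 1 k)%:E)%E.
  by rewrite -integral_gauss_relu; exact: integral_std_normal2_marginal.
have E12 := @integral_relu_pair R h k r r1 r1E.
have L1 := ge0_integral_Lfun1 mX1 X1_ge0 E1.
have L2 := ge0_integral_Lfun1 mX2 X2_ge0 E2.
have L12 : (X1 * X2) \in Lfun std_normal2 1.
  apply: ge0_integral_Lfun1 E12; first exact: measurable_funM.
  by move=> z; exact: (mulr_ge0 (X1_ge0 z) (X2_ge0 z)).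
(* By positive homogeneity of [relu] the rectified pair is [s1 X1], [s2 X2]. *)
have -> : relu \o (fun z : R * R => mu1 + s1 * z.1) = s1 \o* X1.
  apply/funext => z /=; rewrite /X1 [RHS]mulrC -reluM ?ltW// mu1E.
  by congr relu; ring.
have -> : relu \o (fun z : R * R => mu2 + nu12 / s1 * z.1 +
    Num.sqrt (s2 ^+ 2 - nu12 ^+ 2 / s1 ^+ 2) * z.2) = s2 \o* X2.
  apply/funext => z /=; rewrite /X2 [RHS]mulrC -reluM ?ltW// mu2E cE nu12E.
  by congr relu; field.
have sX12 : (s1 \o* X1) * X2 = s1 \o* (X1 * X2).
  by apply/funext => z; rewrite !fctE mulrAC.
(* Bilinearity extracts the scales and leaves [E[X1 X2] - E[X1] E[X2]]. *)
rewrite (covarianceZr s2 (Lfun_scale s1 (lexx 1) L1) L2); last first.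
  by rewrite sX12; exact: Lfun_scale.
rewrite covarianceZl// covarianceE// unlock E12 E1 E2 /=.
rewrite mu1E mu2E nu12E.
(* Treating the remaining values as unknowns leaves an algebraic identity. *)
move: (Phi2_1 h k r) (Phi2_1 k h r) (phi2 h k r) (Phi2 h k r) => a1 a2 a3 a4.
move: (_ + normal_pdf 0 1 h) (_ + normal_pdf 0 1 k) => b1 b2.
by field; rewrite s1n0 s2n0.
Qed.
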